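(* Suppose that, for each real $b\ge1$, we are given a polynomial $P_b(t)$ such that $$\int_{-1/2}^{1/2}\big|b\sqrt{t+1}-P_b(t)\big|\,\frac{dt}{|t|}\le 1 .$$ Then $\lim_{b\to\infty}\deg(P_b)=+\infty$. *)

(* Defs.v *)
From mathcomp Require Import all_boot all_order all_algebra.

Set Implicit Arguments.
Unset Strict Implicit.
Unset Printing Implicit Defensive.

(** The zero polynomial is given degree [0]; since only the eventual growth of
    the degree matters, this convention is harmless. *)
Definition deg (R : nzRingType) (p : {poly R}) : nat := (size p).-1.

(* Main.v *)
(** Suppose [deg p < N] and the weighted error of [p] is at most 1. On each of
    [2N] fixed separated subintervals of [[0, 1/2]] there is a point [t_k] where
    [|b sqrt (1 + t_k) - p(t_k)|] is bounded in terms of [N] only. In the variable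
    [x = sqrt (1 + t)] this says that [g(x) = p(x^2 - 1) - b x], which has degree
    less than [2N], is bounded at [2N] separated points; hence its coefficients
    are bounded in terms of [N]. As [p(x^2 - 1)] is even, the coefficient of [x]
    in [g] is [- b], so [b] is bounded in terms of [N]. *)
Require Import Defs.
From mathcomp Require Import all_boot all_order all_algebra.
From mathcomp Require Import all_classical all_reals all_analysis.
From mathcomp Require Import measurable_realfun ring lra.
Import Order.TTheory GRing.Theory Num.Theory.
Import numFieldNormedType.Exports.

Local Open Scope classical_set_scope.
Local Open Scope ring_scope.

(** Induction on the number of nodes, splitting off a factor ['X - x] at the first one. [C] is fixed
    before [s] and [p], so the bound is uniform over nodes that may vary with the polynomial. *)
Lemma coef_le_separated_values (R : realFieldType) (d B : R) (n : nat) :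
  0 < d -> 0 <= B ->
  exists2 C : R, 0 <= C &
    forall (s : seq R) (p : {poly R}) (e : R), size s = n -> (size p <= n)%N ->
      pairwise (fun x y => d <= `|y - x|) s -> all (fun x => `|x| <= B) s ->
      all (fun x => `|p.[x]| <= e) s -> 0 <= e ->
      forall i, `|p`_i| <= C * e.
Proof.
move=> d0 B0; elim: n => [|n [C C0 IH]].
  exists 0 => // s p e _; rewrite leqn0 size_poly_eq0 => /eqP-> _ _ _ _ i.
  by rewrite coef0 normr0 mul0r.
(* Each coefficient of [q * ('X - x%:P) + p.[x]%:P] is, in absolute value, at most one coefficient
   of [q], plus [B] times another, plus [e]; the quotient has values at most [2 / d * e] at the
   remaining nodes. *)
exists (C * (2 / d) * (1 + B) + 1).
  by rewrite addr_ge0 // !mulr_ge0 // ?addr_ge0 // invr_ge0 ltW.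
case=> // x s p e [ss] sp /andP[dx ps] /andP[xB sB] /andP[px pe] e0 i.
(* Newton interpolation: the quotient [q] is controlled at the other nodes. *)
have [q pq] : exists q, p - p.[x]%:P = q * ('X - x%:P).
  by apply/factor_theorem; rewrite /root !hornerE subrr.
have pE : p = q * ('X - x%:P) + p.[x]%:P by rewrite -pq subrK.
have sq : (size q <= n)%N.
  have [->|q0] := eqVneq q 0; first by rewrite size_poly0.
  have : (size (q * ('X - x%:P))%R <= n.+1)%N.
    rewrite -pq (leq_trans (size_polyD _ _)) // size_polyN geq_max sp /=.
    by rewrite (leq_trans (size_polyC_leq1 _)).
  by rewrite size_Mmonic ?monicXsubC // size_XsubC addn2.
have e20 : 0 <= 2 / d * e by rewrite !mulr_ge0 // invr_ge0 ltW.
have qe : all (fun y => `|q.[y]| <= 2 / d * e) s.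
  apply/allP => y ys; have dy := allP dx _ ys; have py := allP pe _ ys.
  have qy : q.[y] * (y - x) = p.[y] - p.[x].
    by rewrite {1}pE !hornerE addrK.
  rewrite mulrAC ler_pdivlMr // (@le_trans _ _ `|q.[y] * (y - x)|) //.
    by rewrite normrM ler_wpM2l.
  by rewrite qy (le_trans (ler_normB _ _)) // mulr2n mulrDl mul1r lerD.
have qi := IH s q _ ss sq ps sB qe e20.
rewrite pE coefD coefC mulrBr coefB coefMX coefMC.
rewrite [leRHS]mulrDl mul1r (le_trans (ler_normD _ _)) // lerD //; last first.
  by case: eqP; rewrite ?normr0.
have -> : C * (2 / d) * (1 + B) * e = C * (2 / d * e) + C * (2 / d * e) * B.
  by ring.
rewrite (le_trans (ler_normB _ _)) // lerD //.
  by case: eqP => _; [rewrite normr0 mulr_ge0 | exact: qi].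
by rewrite normrM ler_pM.
Qed.

Lemma measurable_weighted_error (R : realType) (D : set R) (b : R) (p : {poly R}) :
  measurable D ->
  measurable_fun D (fun t : R => (`|b * Num.sqrt (t + 1) - p.[t]| / `|t| : R)).
Proof.
move=> mD; apply: (measurable_funS measurableT) => //.
(* Both sides are 0 at [t = 0]: there [`|t|^-1 = 0] and [0 `^ (-1) = 0]. *)
have -> : (fun t : R => `|b * Num.sqrt (t + 1) - p.[t]| / `|t|) =
    (fun t => `|b * Num.sqrt (t + 1) - p.[t]| * (`|t| `^ (-1))).
  by apply/funext => t; rewrite powR_inv1.
apply: measurable_funM.
  apply: measurableT_comp => //; apply: measurable_funB.
    apply: measurable_funM => //; apply: continuous_measurable_fun => t.
    apply: (@continuous_comp _ _ _ (fun t : R => t + 1) Num.sqrt); last exact: sqrt_continuous.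
    by apply: cvgD; [exact: cvg_id | exact: cvg_cst].
  by apply: continuous_measurable_fun; exact: continuous_horner.
by apply: (measurableT_comp (measurable_powR (-1))); exact: normr_measurable.
Qed.

(** Otherwise [f] exceeds [m] throughout, and the integral is at least [m * (c - a) > 1]. *)
Lemma exists_le_of_integral_le1 (R : realType) (f : R -> R) (a c m : R) :
  a < c -> 1 < m * (c - a) -> 0 <= m ->
  measurable_fun `[a, c] (EFin \o f) ->
  (\int[@lebesgue_measure R]_(t in `[a, c]) (f t)%:E <= 1)%E ->
  exists2 t, t \in `[a, c] & f t <= m.
Proof.
move=> ac m1 m0 mf If; apply: contrapT => H.
have fm t : t \in `[a, c] -> m < f t.
  by move=> tJ; rewrite ltNge; apply/negP => ft; apply: H; exists t.
suff : (1 < \int[@lebesgue_measure R]_(t in `[a, c]) (f t)%:E)%E.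
  by rewrite ltNge If.
apply: (@lt_le_trans _ _ (\int[@lebesgue_measure R]_(t in `[a, c]) (cst m%:E t)))%E.
  have -> : (\int[@lebesgue_measure R]_(t in `[a, c]) cst m%:E t =
      (m * (c - a))%:E)%E; last by rewrite lte_fin.
  rewrite EFinM EFinB; have := lebesgue_measure_itv `[a, c].
  by rewrite /= lte_fin ac => <-; apply: integral_cst.
apply: ge0_le_integral => //.
by move=> t tJ; rewrite lee_fin ltW // fm // inE.
Qed.

(** This coefficient is the derivative at 0, where the chain rule yields a factor [2x]. *)
Lemma coef1_comp_Xsqr_sub1 (R : comNzRingType) (p : {poly R}) :
  (p \Po ('X^2 - 1))`_1 = 0.
Proof.
have := coef_deriv (p \Po ('X^2 - 1)) 0; rewrite mulr1n => <-.
rewrite -horner_coef0 deriv_comp derivB derivXn derivC subr0 hornerM hornerMn.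
by rewrite hornerX mul0rn mulr0.
Qed.

Lemma size_comp_Xsqr_sub1 (R : nzRingType) (p : {poly R}) (n : nat) :
  (deg p < n)%N -> (size (p \Po ('X^2 - 1)) <= n.*2)%N.
Proof.
move=> pn; rewrite (leq_trans (size_comp_poly_leq _ _)) // size_XnsubC //=.
by rewrite muln2 ltn_double.
Qed.

Lemma sqrtr_le2 (R : rcfType) (x : R) : x <= 4 -> Num.sqrt x <= 2.
Proof.
move/ler_wsqrtr; rewrite (_ : 4 = 2 ^+ 2); last by ring.
by rewrite sqrtr_sqr ger0_norm.
Qed.

(** Factor [y - x] as a difference of squares of roots; the sum of the roots is at most 4. *)
Lemma sqrt_dist_ge (R : rcfType) (x y : R) : 0 <= x <= 4 -> 0 <= y <= 4 ->
  `|y - x| / 4 <= `|Num.sqrt y - Num.sqrt x|.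
Proof.
move=> /andP[x0 x4] /andP[y0 y4].
rewrite -{1}(sqr_sqrtr y0) -{1}(sqr_sqrtr x0) subr_sqr normrM.
rewrite ler_pdivrMr // ler_wpM2l // ger0_norm ?addr_ge0 ?sqrtr_ge0 //.
by have := sqrtr_le2 _ _ x4; have := sqrtr_le2 _ _ y4; lra.
Qed.

Lemma exists_small_error (R : realType) (b : R) (p : {poly R}) (a h : R) :
  (\int[@lebesgue_measure R]_(t in `[(- (1 / 2))%R, (1 / 2)%R])
       (`|b * Num.sqrt (t + 1) - p.[t]| / `|t|)%R%:E <= 1)%E ->
  0 < a -> 0 < h -> a + h <= 1 / 2 ->
  exists2 t, a <= t <= a + h & `|b * Num.sqrt (t + 1) - p.[t]| <= h^-1.
Proof.
move=> bp a0 h0 ah.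
(* The level [2 / h] gives [2 / h * h = 2 > 1]; clearing the weight multiplies it by [t <= 1 / 2],
   which leaves [h^-1]. *)
have [|||||t] := @exists_le_of_integral_le1 R
    (fun t => `|b * Num.sqrt (t + 1) - p.[t]| / `|t|) a (a + h) (2 / h).
- by rewrite ltrDl.
- by rewrite addrAC subrr add0r divfK ?gt_eqF //; lra.
- by rewrite divr_ge0 // ltW.
- by apply/measurable_EFinP; exact: measurable_weighted_error.
- apply: le_trans bp; apply: ge0_subset_integral => //.
  + by apply/measurable_EFinP; exact: measurable_weighted_error.
  + by move=> x /= /[!in_itv]/= /andP[? ?]; apply/andP; split; lra.
rewrite in_itv => /= /andP[at_ th]; have t0 : 0 < t by lra.
rewrite (gtr0_norm t0) ler_pdivrMr // => pt; exists t; first by rewrite at_.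
rewrite (le_trans pt) // mulrAC ler_piMl ?invr_ge0 ?(ltW h0) //; lra.
Qed.

Lemma low_degree_bound (R : realType) (N : nat) : exists K : R,
  forall (b : R) (p : {poly R}), (deg p < N)%N ->
  (\int[@lebesgue_measure R]_(t in `[(- (1 / 2))%R, (1 / 2)%R])
       (`|b * Num.sqrt (t + 1) - p.[t]| / `|t|)%R%:E <= 1)%E ->
  b <= K.
Proof.
have [->|N0] := posnP N; first by exists 0.
set n := N.*2; have n0 : 0 < n%:R :> R by rewrite ltr0n double_gt0.
(* The intervals from [(2k + 1)h] to [(2k + 2)h], for [k < n], have gaps of length [h], avoid 0 and
   end at [2nh = 1 / 2]. *)
set h : R := (4 * n%:R)^-1; have h0 : 0 < h by rewrite invr_gt0 mulr_gt0.
have hn : n%:R * h = 1 / 4 by rewrite /h; field; rewrite gt_eqF.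
(* Points [t] at distance [h] give nodes [sqrt (t + 1)] at distance at least [h / 4], all bounded by
   2. *)
have [C C0 HC] := @coef_le_separated_values R (h / 4) 2 n
  (divr_gt0 h0 (ltr0n _ 4)) (ler0n _ 2).
exists (C * h^-1) => b p pN bp.
have /choice[t tP] : forall k : nat, exists t : R, (k < n)%N ->
    (2 * k%:R + 1) * h <= t <= (2 * k%:R + 1) * h + h /\
    `|b * Num.sqrt (t + 1) - p.[t]| <= h^-1.
  move=> k; have [kn|nk] := ltnP k n; last by exists 0.
  have kn' : k%:R + 1 <= n%:R :> R by rewrite natr1 ler_nat.
  have [||t ? ?] := exists_small_error R b p ((2 * k%:R + 1) * h) h bp _ h0.
  - by rewrite mulr_gt0 // ltr_wpDl // mulr_ge0.
  - by have := ler_wpM2r (ltW h0) kn'; rewrite hn; lra.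
  by exists t.
have tP0 k : (k < n)%N -> 0 <= t k + 1 <= 4.
  move=> kn; have [/andP[tk tk'] _] := tP k kn.
  have kn' : k%:R + 1 <= n%:R :> R by rewrite natr1 ler_nat.
  have k0 : 0 <= k%:R * h by rewrite mulr_ge0 // ltW.
  by have := ler_wpM2r (ltW h0) kn'; rewrite hn; lra.
pose g := p \Po ('X^2 - 1) - b *: 'X.
have g1 : g`_1 = - b.
  by rewrite coefB coef1_comp_Xsqr_sub1 coefZ coefX mulr1 sub0r.
rewrite (le_trans (ler_norm b)) // -normrN -g1.
apply: (HC (mkseq (fun k => Num.sqrt (t k + 1)) n)) => //.
- exact: size_mkseq.
- rewrite (leq_trans (size_polyD _ _)) // geq_max size_comp_Xsqr_sub1 //=.
  rewrite size_polyN (leq_trans (size_scale_leq _ _)) // size_polyX.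
  (* The term [b *: 'X] has size at most 2, which fits since [N] is positive. *)
  by rewrite -(leq_double 1) in N0.
- rewrite pairwise_map.
  apply: (@sub_in_pairwise _ (mem (iota 0 n)) ltn _ _ (iota 0 n)).
  + move=> i j; rewrite !mem_iota /= !add0n => im jm ij.
    rewrite (le_trans _ (sqrt_dist_ge _ _ _ (tP0 _ im) (tP0 _ jm))) //.
    rewrite ler_pM2r // ler_normr; apply/orP; left.
    (* For [i < j], [t i <= (2i + 2)h] and [t j >= (2j + 1)h >= (2i + 3)h]. *)
    have [/andP[_ ti] _] := tP i im; have [/andP[tj _] _] := tP j jm.
    have ij' : i%:R + 1 <= j%:R :> R by rewrite natr1 ler_nat.
    by have := ler_wpM2r (ltW h0) ij'; lra.
  + exact/allP.
  + by rewrite -sorted_pairwise ?iota_ltn_sorted //; exact: ltn_trans.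
- apply/allP => _ /mapP[k /[!mem_iota]/= kn ->].
  have /andP[_ t4] := tP0 k kn; rewrite ger0_norm ?sqrtr_ge0 //.
  exact: sqrtr_le2.
- apply/allP => _ /mapP[k /[!mem_iota]/= kn ->].
  have /andP[t0 _] := tP0 k kn; have [_ tk] := tP k kn.
  rewrite !hornerE horner_comp !hornerE sqr_sqrtr // addrK.
  by rewrite distrC.
- by rewrite invr_ge0 ltW.
Qed.

Theorem proposition5 (R : realType) (P : R -> {poly R})
  (hP : forall b : R, 1 <= b ->
    (\int[@lebesgue_measure R]_(t in `[(- (1 / 2))%R, (1 / 2)%R])
       (`|b * Num.sqrt (t + 1) - (P b).[t]| / `|t|)%R%:E <= 1)%E) :
  deg (P b) @[b --> +oo] --> \oo.
Proof.
apply/cvgnyPge => N; have [K bK] := low_degree_bound R N.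
(* Once [b] is at least 1 and exceeds [K], a degree below [N] contradicts [b <= K]. *)
near=> b; rewrite leqNgt; apply/negP => PN.
have b1 : 1 <= b by near: b; apply: nbhs_pinfty_ge; exact: num_real.
have := bK b (P b) PN (hP b b1); apply/negP; rewrite -ltNge.
by near: b; apply: nbhs_pinfty_gt; exact: num_real.
Unshelve. all: by end_near.
Qed.
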